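(* Let $T:\mathbb{R}^n\rightrightarrows\mathbb{R}^n$ and $P\in\mathbb{R}^{n\times n}$ satisfy the following. (A1) $T$ is outer semicontinuous. (A2) The preconditioned resolvent $(P+T)^{-1}P$ has full domain $\mathbb{R}^n$, and it is continuous. (A3) $\operatorname{zer}T$ is nonempty, closed and convex, and there is a symmetric, possibly indefinite, matrix $V\in\mathbb{R}^{n\times n}$ such that $T$ has $V$-oblique weak Minty solutions at $\mathcal{S}^\star=\operatorname{zer}T$. (A4) $P$ is symmetric positive semidefinite and $\eta_{\min}:=1+\lambda_{\min}(U^\top VPU)>0$, where $U$ is any matrix whose columns form an orthonormal basis of the range of $P$. (A5) $T$ is metrically subregular with modulus $\zeta\in\mathbb{R}_+$ at all $z^\star\in\operatorname{zer}T$ for $0$. Consider a sequence $(z^k,\bar z^k)_{k\in\mathbb{N}}$ generated by the relaxed preconditioned proximal point algorithm (PPPA) starting from $z^0\in\mathbb{R}^n$ with relaxation parameters $\lambda_k\in(0,2\alpha_k)$ such that $\lambda_k(2\alpha_k-\lambda_k)\ge\kappa>0$ for all $k$ large enough, where $$\alpha_k=1+\frac{\operatorname{q}_V\big(P(z^k-\bar z^k)\big)}{\operatorname{q}_P(z^k-\bar z^k)}.$$ Then $\big(\operatorname{dist}_Q(\Pi z^k,\Pi\operatorname{zer}T)\big)_{k\in\mathbb{N}}$ converges $Q$-linearly to zero with $Q$-factor $\sqrt{1-\kappa/(1+\zeta\|P\|)^2}$, $(\Pi z^k)_{k\in\mathbb{N}}$ converges $R$-linearly to some element of $\Pi\operatorname{zer}T$,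 and $\operatorname{q}_P(z^k-\bar z^k)$ converges $R$-linearly to zero.
   Context: For $T:\mathbb{R}^n\rightrightarrows\mathbb{R}^n$ set-valued: $\operatorname{gph}T=\{(x,y):y\in Tx\}$, $\operatorname{zer}T=\{x:0\in Tx\}$; $T$ is outer semicontinuous if its graph is closed. For a symmetric matrix $M$, $\operatorname{q}_M(x):=\langle x,Mx\rangle$. $T$ has $V$-oblique weak Minty solutions at a nonempty set $\mathcal{S}^\star\subseteq\operatorname{zer}T$ if $\langle v,z-z^\star\rangle\ge\operatorname{q}_V(v)$ for all $z^\star\in\mathcal{S}^\star$ and $(z,v)\in\operatorname{gph}T$. (PPPA): $\bar z^k\in(P+T)^{-1}Pz^k$, $z^{k+1}=z^k+\lambda_k(\bar z^k-z^k)$. $\Pi$ is the orthogonal projection onto the range of $P$; the matrix $Q:=P+\Pi_{\ker P}$, with $\Pi_{\ker P}$ the orthogonal projection onto the kernel of $P$, is positive definite; $\|x\|_Q=\sqrt{\langle x,Qx\rangle}$, $\operatorname{dist}_Q(x,E)=\inf_{e\in E}\|e-x\|_Q$, and $\operatorname{dist}$ without subscript is with respect to the Euclidean norm. $\|P\|$ is the spectral norm. $\lambda_{\min}$ is the smallest eigenvalue of a matrix with real eigenvalues ($U^\top VPU$ is similar to a symmetric matrix). Metric subregularity: $T$ is metrically subregular at $\bar x$ for $\bar y$ with modulus $\zeta$ if $(\bar x,\bar y)\in\operatorname{gph}T$ and there is a neighborhood $\mathcal{U}$ of $\bar x$ with $\operatorname{dist}(x,T^{-1}\bar y)\le\zeta\operatorname{dist}(\bar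 y,Tx)$ for all $x\in\mathcal{U}$. Linear convergence: $(z^k)$ converges to $z^\star$ (at least) $Q$-linearly with $Q$-factor $c\in(0,1)$ if there is $k_0$ such that $\|z^{k+1}-z^\star\|\le c\|z^k-z^\star\|$ for all $k\ge k_0$; it converges (at least) $R$-linearly if $\|z^k-z^\star\|\le v^k$ for some nonnegative scalars $(v^k)$ converging $Q$-linearly to zero. *)

(* Defs.v *)
From HB Require Import structures.
From mathcomp Require Import all_boot all_order all_algebra.
From mathcomp Require Import all_classical all_reals all_analysis.

Set Implicit Arguments.
Unset Strict Implicit.
Unset Printing Implicit Defensive.

Import Order.TTheory GRing.Theory Num.Theory numFieldNormedType.Exports.
Local Open Scope classical_set_scope.
Local Open Scope ring_scope.

(* Vectors of R^n are columns 'cV[R]_n. The library norm on matrices is the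
   sup norm, so the Euclidean inner product and norms are defined here; the
   library (product) topology on 'cV[R]_n is the Euclidean one. *)
Section Euclidean.
Variables (R : realType) (n : nat).
Implicit Types (M P W : 'M[R]_n) (u v x : 'cV[R]_n).

Definition inner u v : R := (u^T *m v) 0 0.

Definition qform M x : R := inner x (M *m x).

Definition mnorm M x : R := Num.sqrt (qform M x).

Definition enorm x : R := Num.sqrt (inner x x).

Definition spectral_norm M : R := sup [set enorm (M *m x) | x in [set x | enorm x <= 1]].

Definition psd M : Prop := forall x, 0 <= qform M x.

(* Meant for a nonempty E: the real inf of the empty set is 0. *)
Definition dist (nrm : 'cV[R]_n -> R) x (E : set 'cV[R]_n) : R :=
  inf [set nrm (e - x) | e in E].

(* Orthogonal projection onto the row space of W, acting on columns:
   the rows of kermx W^T span the orthogonal complement of that row space, and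
   proj_mx acts on rows, whence the outer transpose. *)
Definition orthoproj W : 'M[R]_n := (proj_mx W (kermx W^T))^T.

Definition proj_range P : 'M[R]_n := orthoproj P^T.

(* The rows of kermx P^T are (the transposes of) the x such that P *m x = 0. *)
Definition proj_ker P : 'M[R]_n := orthoproj (kermx P^T).

Definition orthonormal_range_basis (r : nat) P (U : 'M[R]_(n, r)) : Prop :=
  U^T *m U = 1%:M /\ (U^T :=: P^T)%MS.

End Euclidean.

(* For matrices whose eigenvalues are all real. For the 0 x 0 matrix, which
   occurs below when P = 0, this is inf set0 = 0. *)
Definition lambda_min (R : realType) (r : nat) (A : 'M[R]_r) : R :=
  inf [set a | eigenvalue A a].

Section SetValued.
Variables (R : realType) (n : nat).
Local Notation E := 'cV[R]_n.
Implicit Types (T : E -> set E) (P V : 'M[R]_n).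

Definition gph T : set (E * E) := [set p | T p.1 p.2].

Definition inv_map T : E -> set E := fun y => [set x | T x y].

Definition zer T : set E := inv_map T 0.

Definition set_dom T : set E := [set x | T x !=set0].

Definition outer_semicontinuous T : Prop := closed (gph T).

Definition add_map P T : E -> set E := fun x => [set P *m x + y | y in T x].

Definition preconditioned_resolvent P T : E -> set E :=
  fun x => inv_map (add_map P T) (P *m x).

(* Continuity of a set-valued map with full domain, in the sense of a
   continuous function: F is single-valued and continuous. *)
Definition single_valued_continuous (F : E -> set E) : Prop :=
  exists2 f : E -> E, continuous f & forall x, F x = [set f x].

Definition oblique_weak_minty V T (S : set E) : Prop :=
  [/\ S !=set0, S `<=` zer T &
      forall zs z v, S zs -> gph T (z, v) -> qform V v <= inner v (z - zs)].

(* dist(ybar, T x) = +oo when T x is empty, and then there is nothing to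
   require; this is the role of the guard T x !=set0. *)
Definition metrically_subregular T (xbar ybar : E) (zeta : R) : Prop :=
  gph T (xbar, ybar) /\
  \forall x \near xbar, T x !=set0 ->
    dist (@enorm R n) x (inv_map T ybar) <= zeta * dist (@enorm R n) ybar (T x).

Definition PPPA P T (lam : nat -> R) (z zbar : nat -> E) : Prop :=
  forall k, preconditioned_resolvent P T (z k) (zbar k) /\
            z k.+1 = z k + lam k *: (zbar k - z k).

End SetValued.

Section Rates.
Variables (R : realType).

(* The factor 0, i.e. convergence in finitely many steps, is allowed: the factor
   sqrt (1 - kappa / (1 + zeta |P|)^2) can be 0. *)
Definition Qlinear (X : zmodType) (nrm : X -> R) (z : nat -> X) (zs : X) (c : R) :
  Prop :=
  0 <= c < 1 /\ \forall k \near \oo, nrm (z k.+1 - zs) <= c * nrm (z k - zs).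

Definition Rlinear (X : zmodType) (nrm : X -> R) (z : nat -> X) (zs : X) : Prop :=
  exists v : nat -> R, [/\ forall k, 0 <= v k,
    exists c, Qlinear (fun x : R => `|x|) v 0 c &
    forall k, nrm (z k - zs) <= v k].

End Rates.

(* Main.v *)
Require Import Defs.
From HB Require Import structures.
From mathcomp Require Import all_boot all_order all_algebra.
From mathcomp Require Import all_classical all_reals all_analysis.
From mathcomp Require Import ring lra.

(** Write w = z - zbar, where zbar is the resolvent of z, so that P w lies in
    T zbar.  The oblique weak Minty inequality at a zero s of T then reads
    <P w, z - s> >= a * q_P(w), a being the step-size bound alpha, and expanding
    the square gives Fejer monotonicity in the seminorm of P
    ([relaxed_step_fejer]):
      q_P(z+ - s) <= q_P(z - s) - l (2 a - l) q_P(w).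
    The norm of Q restricted to the range of P is the seminorm of P
    ([mnorm_proj_range]), so that the first claim is about the distance d_k of
    z_k to zer T in this seminorm.

    Taking the infimum over s gives d_(k+1)^2 <= d_k^2 - kappa q_P(w_k) for k
    large, and linear convergence follows from a bound of d_k by a multiple of
    the seminorm of w_k.  Metric subregularity provides one ([error_bound]):
    since |P w| <= |P|^(1/2) ||w||_P and ||x||_P <= |P|^(1/2) |x|,
      d_k <= ||w_k||_P + |P|^(1/2) dist(zbar_k, zer T)
          <= (1 + zeta |P|) ||w_k||_P.
    Subregularity is local, so zbar_k must first be shown to converge to a zero
    of T ([fejer_convergence]).  The iterates need not be bounded along the
    kernel of P, but the resolvent f depends on P z only, hence on the
    projection of z, and the projected iterates are bounded by Fejer
    monotonicity.  At a cluster point x of these, continuity of f and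
    ||w_k||_P -> 0 give P x = P (f x), which says that f x is a zero of T.  Fejer
    monotonicity with respect to f x turns the cluster point into a limit.

    The remaining claims follow from the first: a Fejer sequence stays within
    2 d_k of its limit ([fejer_limit_dist]), and the decrease inequality bounds
    q_P(w_k) by d_k^2 / kappa. *)

Set Implicit Arguments.
Unset Strict Implicit.

Import Order.TTheory GRing.Theory Num.Theory numFieldNormedType.Exports.
Local Open Scope classical_set_scope.
Local Open Scope ring_scope.

(** * Seminorms of positive semidefinite matrices and the spectral norm *)

Section SemiInner.
Variables (R : realType) (n : nat).
Implicit Types (M A : 'M[R]_n) (u v x y : 'cV[R]_n).

Lemma innerC u v : inner u v = inner v u.
Proof. by rewrite /inner -{1}[u^T *m v]trmxK trmx_mul trmxK mxE. Qed.

Lemma innerDl u v w : inner (u + v) w = inner u w + inner v w.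
Proof. by rewrite /inner linearD mulmxDl mxE. Qed.

Lemma innerZl a u v : inner (a *: u) v = a * inner u v.
Proof. by rewrite /inner linearZ /= -scalemxAl mxE. Qed.

Lemma innerDr u v w : inner w (u + v) = inner w u + inner w v.
Proof. by rewrite !(innerC w) innerDl. Qed.

Lemma innerZr a u v : inner u (a *: v) = a * inner u v.
Proof. by rewrite !(innerC u) innerZl. Qed.

Lemma inner_mulmxl A u v : inner (A *m u) v = inner u (A^T *m v).
Proof. by rewrite /inner trmx_mul mulmxA. Qed.

Lemma innerE u v : inner u v = \sum_i u i 0 * v i 0.
Proof. by rewrite /inner mxE; apply: eq_bigr => i _; rewrite mxE. Qed.

Lemma inner_ge0 u : 0 <= inner u u.
Proof. by rewrite innerE sumr_ge0 // => i _; rewrite -expr2 sqr_ge0. Qed.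

Lemma inner_eq0 u : inner u u = 0 -> u = 0.
Proof.
rewrite innerE => /eqP; rewrite psumr_eq0; last first.
  by move=> i _; rewrite -expr2 sqr_ge0.
move=> /allP u0; apply/colP => i; rewrite mxE.
by have := u0 i (mem_index_enum i); rewrite /= mulf_eq0 orbb => /eqP.
Qed.

Lemma qformDZ M x y t : M^T = M ->
  qform M (x + t *: y) =
  qform M x + 2 * t * inner x (M *m y) + t ^+ 2 * qform M y.
Proof.
move=> Msym; rewrite /qform mulmxDr -scalemxAr.
rewrite !(innerDl, innerDr, innerZl, innerZr).
by rewrite (innerC y (M *m x)) inner_mulmxl Msym; ring.
Qed.

Lemma qformZ M t x : qform M (t *: x) = t ^+ 2 * qform M x.
Proof. by rewrite /qform -scalemxAr innerZl innerZr; ring. Qed.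

Lemma qform1 x : qform 1%:M x = inner x x.
Proof. by rewrite /qform mul1mx. Qed.

Lemma psd1 : psd (1%:M : 'M[R]_n).
Proof. by move=> x; rewrite qform1 inner_ge0. Qed.

Lemma enormE x : enorm x = mnorm 1%:M x.
Proof. by rewrite /mnorm qform1. Qed.

Lemma mnorm_ge0 M x : 0 <= mnorm M x.
Proof. exact: sqrtr_ge0. Qed.

Lemma enorm_ge0 x : 0 <= enorm x.
Proof. exact: sqrtr_ge0. Qed.

Lemma sqr_mnorm M x : psd M -> mnorm M x ^+ 2 = qform M x.
Proof. by move=> Mpsd; rewrite sqr_sqrtr. Qed.

Lemma sqr_enorm x : enorm x ^+ 2 = inner x x.
Proof. by rewrite sqr_sqrtr// inner_ge0. Qed.

Lemma mnormZ M t x : mnorm M (t *: x) = `|t| * mnorm M x.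
Proof. by rewrite /mnorm qformZ sqrtrM ?sqr_ge0// sqrtr_sqr. Qed.

Lemma enormZ t x : enorm (t *: x) = `|t| * enorm x.
Proof. by rewrite !enormE mnormZ. Qed.

Lemma mnormN M x : mnorm M (- x) = mnorm M x.
Proof. by rewrite -scaleN1r mnormZ normrN1 mul1r. Qed.

Lemma mnormBC M x y : mnorm M (x - y) = mnorm M (y - x).
Proof. by rewrite -mnormN opprB. Qed.

Lemma enorm0_eq0 x : enorm x = 0 -> x = 0.
Proof.
by move=> x0; apply: inner_eq0; rewrite -sqr_enorm x0 expr0n.
Qed.

(** For an M that may be degenerate: the form is nonnegative at every
    combination s *: x + t *: y, and two choices of (s, t) suffice. *)
Lemma cauchy_schwarz M x y : M^T = M -> psd M ->
  inner x (M *m y) <= mnorm M x * mnorm M y.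
Proof.
move=> Msym Mpsd; set b := inner x (M *m y).
have P0 s t : 0 <= s ^+ 2 * qform M x + 2 * t * s * b + t ^+ 2 * qform M y.
  by have := Mpsd (s *: x + t *: y); rewrite qformDZ // qformZ innerZl mulrA.
suff : b ^+ 2 <= qform M x * qform M y.
  move=> b2; apply: le_trans (ler_norm _) _.
  by rewrite -sqrtr_sqr /mnorm -sqrtrM// ler_wsqrtr.
have x0 := Mpsd x; have y0 := Mpsd y.
move: (qform M x) (qform M y) P0 x0 y0 => a c P0 a0 c0.
have [c_eq0|c_neq0] := eqVneq c 0.
  rewrite c_eq0 in P0 *.
  have [->|b0] := eqVneq b 0; first by rewrite expr0n mulr0.
  (* If y is isotropic, the form is affine in t, hence b must vanish: the
     following t would give it the value -1. *)
  have := P0 1 (- (a + 1) / (2 * b)).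
  rewrite (_ : _ + _ = -1) ?oppr_ge0 ?ler10 //.
  by field.
have c_gt0 : 0 < c by rewrite lt_neqAle eq_sym c_neq0.
(* This choice of (s, t) minimizes the form along y, up to the factor c. *)
have := P0 c (- b); rewrite (_ : _ + _ = c * (a * c - b ^+ 2)); last by ring.
by rewrite pmulr_rge0// subr_ge0.
Qed.

Lemma mnormD M x y : M^T = M -> psd M ->
  mnorm M (x + y) <= mnorm M x + mnorm M y.
Proof.
move=> Msym Mpsd.
rewrite -(@ler_pXn2r _ 2)// ?nnegrE ?addr_ge0 ?mnorm_ge0//.
have := qformDZ x y 1 Msym; rewrite scale1r sqr_mnorm// => ->.
rewrite sqrrD !sqr_mnorm// expr1n mul1r mulr1 lerD2r lerD2l.
by rewrite -[leRHS]mulr_natl ler_wpM2l// cauchy_schwarz.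
Qed.

Lemma enorm_cauchy_schwarz x y : inner x y <= enorm x * enorm y.
Proof.
by rewrite -{1}[y]mul1mx !enormE cauchy_schwarz ?trmx1//; exact: psd1.
Qed.

Lemma enormD x y : enorm (x + y) <= enorm x + enorm y.
Proof. by rewrite !enormE mnormD ?trmx1//; exact: psd1. Qed.

Lemma enorm_coord x i : `|x i 0| <= enorm x.
Proof.
rewrite -sqrtr_sqr ler_wsqrtr// innerE (bigD1 i)//= -expr2 lerDl sumr_ge0//.
by move=> j _; rewrite -expr2 sqr_ge0.
Qed.

Lemma enorm_le_coord x e : 0 <= e -> (forall i, `|x i 0| <= e) ->
  enorm x <= Num.sqrt n%:R * e.
Proof.
move=> e0 xe; rewrite -[X in _ * X](ger0_norm e0) -sqrtr_sqr -sqrtrM ?ler0n//.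
rewrite ler_wsqrtr// innerE mulr_natl -[n in X in _ <= X]card_ord -sumr_const.
apply: ler_sum => i _; rewrite -expr2 -real_normK ?num_real//.
by rewrite lerXn2r ?nnegrE.
Qed.

Lemma mulmx_bounded A :
  exists2 C, 0 <= C & forall x, enorm (A *m x) <= C * enorm x.
Proof.
pose a : R := \sum_i enorm (row i A)^T.
have a0 : 0 <= a by apply: sumr_ge0 => i _; exact: enorm_ge0.
exists (Num.sqrt n%:R * a); first by rewrite mulr_ge0 ?sqrtr_ge0.
move=> x; rewrite -mulrA; apply: enorm_le_coord => [|i].
  by rewrite mulr_ge0 ?enorm_ge0.
have Ei : (A *m x) i 0 = inner (row i A)^T x.
  by rewrite innerE mxE; apply: eq_bigr => j _; rewrite !mxE.
apply: (@le_trans _ _ (enorm (row i A)^T * enorm x)).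
  rewrite Ei ler_norml enorm_cauchy_schwarz andbT lerNl.
  rewrite -mulN1r -innerZl (le_trans (enorm_cauchy_schwarz _ _))//.
  by rewrite enormZ normrN1 mul1r.
rewrite ler_wpM2r ?enorm_ge0// /a (bigD1 i)//= lerDl sumr_ge0// => j _.
exact: enorm_ge0.
Qed.

Lemma spectral_norm_ub A x : enorm (A *m x) <= spectral_norm A * enorm x.
Proof.
have [C C0 hC] := mulmx_bounded A.
pose S : set R := [set enorm (A *m x) | x in [set x | enorm x <= 1]].
have Sub : has_ubound S.
  exists C => _ [y y1 <-]; apply: le_trans (hC y) _.
  by rewrite -[leRHS]mulr1 ler_wpM2l.
have [x0|x_neq0] := eqVneq (enorm x) 0.
  by have := hC x; rewrite x0 !mulr0.
have x_gt0 : 0 < enorm x by rewrite lt_neqAle eq_sym x_neq0 enorm_ge0.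
rewrite -ler_pdivrMr// mulrC.
have -> : (enorm x)^-1 * enorm (A *m x) = enorm (A *m ((enorm x)^-1 *: x)).
  by rewrite -scalemxAr enormZ gtr0_norm// invr_gt0.
apply: ub_le_sup => //; exists ((enorm x)^-1 *: x) => //=.
by rewrite enormZ gtr0_norm ?invr_gt0// mulVf.
Qed.

Lemma spectral_norm_ge0 A : 0 <= spectral_norm A.
Proof.
have [C C0 hC] := mulmx_bounded A.
apply: (@le_trans _ _ (enorm (A *m 0))); first exact: enorm_ge0.
apply: ub_le_sup.
  exists C => _ [y y1 <-]; apply: le_trans (hC y) _.
  by rewrite -[leRHS]mulr1 ler_wpM2l.
exists 0 => //=.
by rewrite /enorm -qform1 -(scale0r 0) qformZ expr0n mul0r sqrtr0.
Qed.

Lemma mnorm_le_enorm M x : psd M ->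
  mnorm M x <= Num.sqrt (spectral_norm M) * enorm x.
Proof.
move=> Mpsd; have sM := spectral_norm_ge0 M.
rewrite -[X in _ * X](ger0_norm (enorm_ge0 x)) -sqrtr_sqr -sqrtrM//.
rewrite ler_wsqrtr// (le_trans (enorm_cauchy_schwarz _ _))//.
rewrite expr2 mulrCA ler_wpM2l ?enorm_ge0//; exact: spectral_norm_ub.
Qed.

(** Cauchy-Schwarz for M at the pair x, M x bounds |M x|^2 by
    ||x||_M ||M x||_M, and ||M x||_M is at most |M|^(1/2) |M x|.  The crude
    bound |M x| <= |M| |x| would not do, since x is only controlled modulo the
    kernel of M. *)
Lemma enorm_mulmx_le_mnorm M x : M^T = M -> psd M ->
  enorm (M *m x) <= Num.sqrt (spectral_norm M) * mnorm M x.
Proof.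
move=> Msym Mpsd.
have [x0|x_neq0] := eqVneq (enorm (M *m x)) 0.
  by rewrite x0 mulr_ge0 ?sqrtr_ge0.
have x_gt0 : 0 < enorm (M *m x).
  by rewrite lt_neqAle eq_sym x_neq0 enorm_ge0.
rewrite -(ler_pM2r x_gt0).
rewrite -expr2 sqr_enorm; apply: le_trans (cauchy_schwarz _ _ Msym Mpsd) _.
by rewrite mulrAC ler_wpM2r ?mnorm_ge0 ?mnorm_le_enorm.
Qed.

Lemma mnorm_eq0 M x : M^T = M -> psd M -> mnorm M x = 0 -> M *m x = 0.
Proof.
move=> Msym Mpsd x0; apply: enorm0_eq0; apply/eqP.
rewrite eq_le enorm_ge0 andbT.
by rewrite (le_trans (enorm_mulmx_le_mnorm _ Msym Mpsd))// x0 mulr0.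
Qed.

Lemma mnorm_congr M x y : M^T = M -> M *m x = M *m y -> mnorm M x = mnorm M y.
Proof.
move=> Msym xy; rewrite /mnorm /qform xy -[M in inner x (M *m y)]Msym.
by rewrite -inner_mulmxl xy innerC.
Qed.

End SemiInner.

(** * Orthogonal projections onto the range and the kernel *)

Section Projections.
Variables (R : realType) (n : nat).
Implicit Types (W P : 'M[R]_n).

(** Over the reals, y W W^T = 0 forces |y W|^2 = 0. *)
Lemma capmx_ker_tr W : (W :&: kermx W^T = 0)%MS.
Proof.
apply/eqP/rowV0P => v; rewrite sub_capmx => /andP[/submxP[y ->]].
rewrite sub_kermx => /eqP yWW.
have : inner (y *m W)^T (y *m W)^T = 0.
  by rewrite /inner trmxK trmx_mul mulmxA yWW mul0mx mxE.
by move=> /inner_eq0 /(congr1 trmx); rewrite trmxK trmx0.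
Qed.

Lemma addmx_ker_tr W : (1%:M <= W + kermx W^T)%MS.
Proof.
have := mxrank_sum_cap W (kermx W^T); rewrite capmx_ker_tr mxrank0 addn0.
rewrite sub1mx /row_full => ->.
by rewrite mxrank_ker mxrank_tr subnKC// rank_leq_col.
Qed.

Lemma proj_rangeE P : exists X, proj_range P = P *m X.
Proof.
have /submxP[Y YE] := proj_mx_sub P^T (kermx P^T^T) 1%:M.
exists Y^T; rewrite /proj_range /orthoproj -[proj_mx _ _]mul1mx YE.
by rewrite trmx_mul trmxK.
Qed.

Lemma mulmx_proj_range P : P^T = P -> P *m proj_range P = P.
Proof.
move=> Psym; apply: trmx_inj; rewrite trmx_mul trmxK !Psym.
have := proj_mx_compl_sub (addmx_ker_tr P^T).
by rewrite !Psym sub_kermx mulmxBl !mul1mx subr_eq0 => /eqP/esym.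
Qed.

Lemma proj_ker_range P : P^T = P -> proj_ker P *m proj_range P = 0.
Proof.
move=> Psym; have [X ->] := proj_rangeE P; rewrite mulmxA.
suff -> : proj_ker P *m P = 0 by rewrite mul0mx.
apply: trmx_inj; rewrite trmx_mul trmxK trmx0.
apply: proj_mx_0; first exact: capmx_ker_tr.
apply/sub_kermxP; rewrite -trmx_mul Psym.
by rewrite (sub_kermxP (submx_refl (kermx P))) trmx0.
Qed.

(** The kernel summand of Q vanishes on the range of P, and P does not see the
    component of x in its kernel. *)
Lemma mnorm_proj_range P x : P^T = P ->
  mnorm (P + proj_ker P) (proj_range P *m x) = mnorm P x.
Proof.
move=> Psym; rewrite /mnorm /qform mulmxDl !mulmxA mulmx_proj_range//.
rewrite proj_ker_range// mul0mx addr0 inner_mulmxl mulmxA.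
by rewrite -{2}Psym -trmx_mul mulmx_proj_range// Psym.
Qed.

(** The seminorm of P is a norm on the range of P: the projection, being
    symmetric and of the form P X, is also X^T P, and |P x| is controlled by the
    seminorm of x. *)
Lemma enorm_proj_range P : P^T = P -> psd P ->
  exists2 C, 0 <= C & forall x, enorm (proj_range P *m x) <= C * mnorm P x.
Proof.
move=> Psym Ppsd; have [X PX] := proj_rangeE P.
have PiPi : (proj_range P)^T *m proj_range P = proj_range P.
  (* This is the transpose of P Pi = P, multiplied by X on the right. *)
  have := congr1 (mulmxr X) (congr1 trmx (mulmx_proj_range Psym)).
  by rewrite /= trmx_mul Psym -!mulmxA -PX.
have -> : proj_range P = X^T *m P.
  by rewrite -PiPi {1}PX trmx_mul Psym -mulmxA mulmx_proj_range.
have [C C0 hC] := mulmx_bounded X^T.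
exists (C * Num.sqrt (spectral_norm P)); first by rewrite mulr_ge0 ?sqrtr_ge0.
move=> x; rewrite -mulmxA -mulrA; apply: le_trans (hC _) _.
by rewrite ler_wpM2l// enorm_mulmx_le_mnorm.
Qed.

End Projections.
(** * The Euclidean norm and the product topology *)

Section Topology.
Variables (R : realType) (n : nat).
Implicit Types (x y : 'cV[R]_n).

Lemma enorm_lt_ball x y e : enorm (y - x) < e -> ball x e y.
Proof.
move=> xy; split=> [|i j]; first exact: le_lt_trans (enorm_ge0 _) xy.
rewrite ord1 /ball/= distrC.
by apply: le_lt_trans xy; have := enorm_coord (y - x) i; rewrite !mxE.
Qed.

Lemma coord_lt_enorm e : 0 < e ->
  exists2 d, 0 < d & forall x, (forall i, `|x i 0| < d) -> enorm x < e.
Proof.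
move=> e0; have s0 : 0 < Num.sqrt (n%:R : R) + 1 by rewrite ltr_wpDl ?sqrtr_ge0.
exists (e / (Num.sqrt n%:R + 1)); first by rewrite divr_gt0.
move=> x xd.
apply: (@le_lt_trans _ _ (Num.sqrt n%:R * (e / (Num.sqrt n%:R + 1)))).
  by apply: enorm_le_coord => [|i]; [rewrite divr_ge0 ?ltW|exact: ltW].
by rewrite mulrA ltr_pdivrMr// mulrDr mulr1 mulrC ltrDl.
Qed.

Lemma near_enorm x e : 0 < e -> \forall y \near x, enorm (y - x) < e.
Proof.
move=> /coord_lt_enorm[d d0 dE]; apply/nbhs_ballP; exists d => //= y xy.
apply: dE => i; have := xy.2 i 0; rewrite /ball/= distrC.
by rewrite !mxE.
Qed.

Lemma bounded_cluster (u : nat -> 'cV[R]_n) M : (forall k, enorm (u k) <= M) ->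
  exists x, forall e N, 0 < e -> exists2 k, (N <= k)%N & enorm (u k - x) < e.
Proof.
move=> uM.
have Kc : compact [set v : 'rV[R]_n | forall i, v ord0 i \in `[- M, M]].
  apply: (@rV_compact _ _ (fun=> `[- M, M]%classic)) => _.
  exact: segment_compact.
have [|y [_ yc]] := Kc ((u k)^T @[k --> \oo]) _.
  exists 0 => // k _ i /=; rewrite mxE in_itv /= -ler_norml.
  exact: le_trans (enorm_coord _ _) (uM k).
exists y^T => e N e0.
have [d d0 dE] := coord_lt_enorm e0.
have [|_ [[k Nk <-] [_ yk]]] :=
    yc [set (u k)^T | k in [set k | (N <= k)%N]] _ _ (nbhsx_ballx y d d0).
  by exists N => // k Nk; exists k.
exists k => //; apply: dE => i.
by have := yk 0 i; rewrite /ball/= distrC !mxE.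
Qed.

End Topology.

(** * Distances *)

Section Dist.
Variables (R : realType) (n : nat).
Implicit Types (x : 'cV[R]_n) (E : set 'cV[R]_n) (nrm : 'cV[R]_n -> R).

Lemma dist_le nrm x E e : (forall u, 0 <= nrm u) -> E e ->
  dist nrm x E <= nrm (e - x).
Proof.
move=> nrm0 Ee; apply: ge_inf; last by exists e.
by exists 0 => _ [y _ <-].
Qed.

Lemma le_dist nrm x E c : E !=set0 -> (forall e, E e -> c <= nrm (e - x)) ->
  c <= dist nrm x E.
Proof.
move=> [e Ee] cE; apply: lb_le_inf; first by exists (nrm (e - x)), e.
by move=> _ [y Ey <-]; exact: cE.
Qed.

Lemma dist_proj_range (P : 'M[R]_n) x E : P^T = P ->
  dist (mnorm (P + proj_ker P)) (proj_range P *m x)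
    [set proj_range P *m e | e in E] = dist (mnorm P) x E.
Proof.
move=> Psym; rewrite /dist image_comp; congr inf.
by apply: eq_imagel => e _ /=; rewrite -mulmxBr mnorm_proj_range.
Qed.

End Dist.

(** * Rates of convergence *)

Section Rates.
Variables (R : realType) (X : zmodType).

(** R-linear convergence asks for a majorant at every index, while the
    domination is only eventual: the finitely many first terms majorize
    themselves, which leaves the eventual Q-linearity intact. *)
Lemma Rlinear_dominated (nrm : X -> R) (y : nat -> X) ys (d : nat -> R) c K :
  (forall u, 0 <= nrm u) -> (forall k, 0 <= d k) -> 0 <= K ->
  Qlinear (fun x : R => `|x|) d 0 c ->
  (\forall k \near \oo, nrm (y k - ys) <= K * d k) -> Rlinear nrm y ys.
Proof.
move=> nrm0 d0 K0 [c01 [N _ dc]] [N' _ yd].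
exists (fun k => if (k < N')%N then nrm (y k - ys) else K * d k); split.
- by move=> k; case: ifP => _ //; rewrite mulr_ge0.
- exists c; split=> //; exists (maxn N N') => // k /=.
  rewrite geq_max => /andP[Nk N'k].
  rewrite !ltnNge N'k (leq_trans N'k (leqnSn k)) /= !subr0 !normrM.
  by rewrite mulrCA ler_wpM2l//; have := dc k Nk; rewrite !subr0.
- by move=> k; case: ltnP => // N'k; exact: yd.
Qed.

End Rates.

(** * Fejer monotone sequences in the seminorm of P *)

Section Fejer.
Variables (R : realType) (n : nat) (P : 'M[R]_n).
Hypotheses (Psym : P^T = P) (Ppsd : psd P).
Local Notation E := 'cV[R]_n.
Local Notation Pi := (proj_range P).
Local Notation "|| x ||_P" := (mnorm P x) (at level 0, x at level 40).

Lemma fejer_homo (S : set E) (z : nat -> E) s k m :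
  (forall s k, S s -> ||(z k.+1 - s)||_P <= ||(z k - s)||_P) ->
  S s -> (k <= m)%N -> ||(z m - s)||_P <= ||(z k - s)||_P.
Proof.
move=> zfejer Ss km.
suff /(_ _ _ km) : {homo (fun j => ||(z j - s)||_P) :
  i j / (i <= j)%N >-> j <= i} by [].
by apply/nonincreasing_seqP => j; exact: zfejer.
Qed.

Lemma cvg_proj_range (z : nat -> E) zs :
  ||(z k - zs)||_P @[k --> \oo] --> 0 -> (Pi *m z k) @[k --> \oo] --> Pi *m zs.
Proof.
have [C C0 hC] := enorm_proj_range Psym Ppsd.
move=> /cvgr0Pnorm_lt z0; apply/cvg_ballP => e e0.
have C1 : 0 < C + 1 by rewrite ltr_wpDl.
have := z0 (e / (C + 1)) (divr_gt0 e0 C1); apply: filterS => k.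
rewrite ger0_norm ?mnorm_ge0// ltr_pdivlMr// => ze.
apply: enorm_lt_ball; rewrite -mulmxBr.
apply: le_lt_trans (hC _) (le_lt_trans _ ze).
by rewrite mulrC ler_wpM2l ?mnorm_ge0// lerDl.
Qed.

(** The model for f is the resolvent and for S the zeros of T.  Convergence of z
    itself can only be expected modulo the kernel of P, whereas f, which factors
    through P, converges in the full space; the limit is the same because
    P x = P (f x) makes f x a fixed point of f. *)
Lemma fejer_convergence (S : set E) (f : E -> E) (z : nat -> E) :
  continuous f -> (forall x y, P *m x = P *m y -> f x = f y) ->
  (forall x, P *m x = P *m f x -> S (f x)) -> S !=set0 ->
  (forall s k, S s -> ||(z k.+1 - s)||_P <= ||(z k - s)||_P) ->
  ||(z k - f (z k))||_P @[k --> \oo] --> 0 ->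
  exists2 zs, S zs & ||(z k - zs)||_P @[k --> \oo] --> 0 /\
                     f (z k) @[k --> \oo] --> zs.
Proof.
move=> fcont fP fS [s Ss] zfejer w0.
have mono t k m : S t -> (k <= m)%N -> ||(z m - t)||_P <= ||(z k - t)||_P.
  exact: fejer_homo.
have PPi x : P *m (Pi *m x) = P *m x by rewrite mulmxA mulmx_proj_range.
have [C C0 hC] := enorm_proj_range Psym Ppsd.
(* The projected iterates are bounded, as the distance of the iterates to s
   decreases; x is one of their cluster points. *)
have [x xc] : exists x, forall e N, 0 < e ->
    exists2 k, (N <= k)%N & enorm (Pi *m z k - x) < e.
  apply: (bounded_cluster
    (M := C * ||(z 0%N - s)||_P + enorm (Pi *m s))) => k.
  rewrite -[Pi *m z k](subrK (Pi *m s)); apply: le_trans (enormD _ _) _.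
  rewrite lerD2r -mulmxBr; apply: le_trans (hC _) _.
  by rewrite ler_wpM2l// mono.
pose D := Num.sqrt (spectral_norm P).
have D0 : 0 <= D by exact: sqrtr_ge0.
have D1 : 0 < D + 1 by rewrite ltr_wpDl.
have hD y : ||y||_P <= (D + 1) * enorm y.
  apply: le_trans (mnorm_le_enorm _ Ppsd) _.
  by rewrite ler_wpM2r ?enorm_ge0// lerDl.
(* The three terms of the decomposition of x - f x below are small by the choice
   of k, by the vanishing of the residuals, and by continuity of f. *)
have xfx : ||(x - f x)||_P = 0.
  apply/eqP; rewrite eq_le mnorm_ge0 andbT; apply/ler_addgt0Pr => e e0.
  rewrite add0r.
  pose e3 := e / 3 / (D + 1).
  have e30 : 0 < e3 by rewrite !divr_gt0.
  have /nbhs_ballP[d d0 hd] : \forall y \near x, enorm (f y - f x) < e3.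
    exact: (fcont x _ (near_enorm (f x) e30)).
  have [N _ hN] : \forall k \near \oo, ||(z k - f (z k))||_P < e / 3.
    have /cvgr0Pnorm_lt/(_ _ (divr_gt0 e0 (ltr0n R 3))) := w0.
    by apply: filterS => k; rewrite ger0_norm ?mnorm_ge0.
  have m0 : 0 < Num.min e3 d by rewrite lt_min e30.
  have [k Nk] := xc _ N m0; rewrite lt_min => /andP[ke3 kd].
  have := hd _ (enorm_lt_ball kd); rewrite (fP (Pi *m z k) (z k))// => fke3.
  rewrite (_ : x - f x =
    (x - Pi *m z k) + ((Pi *m z k - f (z k)) + (f (z k) - f x))).
    have E3 : e = e / 3 + (e / 3 + e / 3) by field.
    rewrite E3; apply: le_trans (mnormD _ _ Psym Ppsd) (lerD _ _).
      rewrite mnormBC (le_trans (hD _))// mulrC -ler_pdivlMr//; exact: ltW.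
    apply: le_trans (mnormD _ _ Psym Ppsd) (lerD _ _).
      by rewrite (mnorm_congr (y := z k - f (z k))) ?mulmxBr ?PPi// ltW ?hN.
    rewrite (le_trans (hD _))// mulrC -ler_pdivlMr//; exact: ltW.
  by rewrite !addrA !subrK.
have Pfx : P *m x = P *m f x.
  by apply/eqP; rewrite -subr_eq0 -mulmxBr mnorm_eq0.
have Sfx : S (f x) by exact: fS.
have zfx : ||(z k - f x)||_P @[k --> \oo] --> 0.
  apply/cvgr0Pnorm_lt => e e0.
  have [N _ hN] := xc (e / (D + 1)) 0%N (divr_gt0 e0 D1).
  exists N => // k Nk; rewrite ger0_norm ?mnorm_ge0//.
  apply: le_lt_trans (mono _ _ _ Sfx Nk) _.
  rewrite (mnorm_congr (y := Pi *m z N - x)) ?mulmxBr ?PPi ?Pfx//.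
  by apply: le_lt_trans (hD _) _; rewrite mulrC -ltr_pdivlMr.
exists (f x) => //; split=> //.
have -> : (fun k => f (z k)) = f \o (fun k => Pi *m z k).
  by apply/funext => k /=; apply: fP; rewrite PPi.
have ffx : f (Pi *m f x) = f x by apply: fP; rewrite PPi -Pfx.
have fc : f @ (Pi *m f x) --> f (Pi *m f x) by exact: fcont.
by rewrite ffx in fc; exact: cvg_comp (cvg_proj_range zfx) fc.
Qed.

(** All the later iterates, hence the limit, are at most as far from s as z k
    is, and the infimum over s in S is taken in the triangle inequality. *)
Lemma fejer_limit_dist (S : set E) (z : nat -> E) zs k : S !=set0 ->
  (forall s k, S s -> ||(z k.+1 - s)||_P <= ||(z k - s)||_P) ->
  ||(z k - zs)||_P @[k --> \oo] --> 0 ->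
  ||(z k - zs)||_P <= 2 * dist (mnorm P) (z k) S.
Proof.
move=> S0 zfejer /cvgr0Pnorm_lt zs0.
rewrite mulrC -ler_pdivrMr//; apply: le_dist => // s Ss.
rewrite ler_pdivrMr// mulr_natr mulr2n mnormBC.
have -> : zs - z k = (zs - s) + (s - z k) by rewrite addrA subrK.
apply: le_trans (mnormD _ _ Psym Ppsd) _; rewrite lerD2r.
rewrite [leRHS]mnormBC; apply/ler_addgt0Pl => e /zs0[N _ zsN].
pose m := maxn N k.
have -> : zs - s = (zs - z m) + (z m - s) by rewrite addrA subrK.
apply: le_trans (mnormD _ _ Psym Ppsd) (lerD _ _).
  rewrite mnormBC -[leLHS]ger0_norm ?mnorm_ge0//; apply/ltW/zsN.
  exact: leq_maxl.
exact: fejer_homo zfejer Ss (leq_maxr N k).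
Qed.

End Fejer.

(** * The relaxed preconditioned proximal point step *)

Section Step.
Variables (R : realType) (n : nat).
Local Notation E := 'cV[R]_n.
Variables (T : E -> set E) (P V : 'M[R]_n).
Hypotheses (Psym : P^T = P) (Ppsd : psd P).

Lemma resolventP (z zb : E) :
  preconditioned_resolvent P T z zb <-> T zb (P *m (z - zb)).
Proof.
rewrite mulmxBr; split=> [[y Ty <-]|Tzb]; first by rewrite addrC addKr.
by exists (P *m z - P *m zb) => //; rewrite addrC subrK.
Qed.

(** The Minty inequality at zb, rewritten at z = zb + w, says that the inner
    product of P w and z - zs is at least a * qform P w; it is the cross term in
    the expansion of the left-hand side.  If qform P w vanishes then so does
    P w, and both sides are equal. *)
Lemma relaxed_step_fejer (z zb zs : E) l a : oblique_weak_minty V T (zer T) ->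
  zer T zs -> preconditioned_resolvent P T z zb ->
  (qform P (z - zb) != 0 ->
    a = 1 + qform V (P *m (z - zb)) / qform P (z - zb)) -> 0 < l ->
  qform P (z + l *: (zb - z) - zs) <=
    qform P (z - zs) - l * (2 * a - l) * qform P (z - zb).
Proof.
move=> [_ _ minty] Szs /resolventP Tzb aE l0.
have := minty zs zb (P *m (z - zb)) Szs Tzb.
set w := z - zb in Tzb aE *.
have -> : zb - zs = (z - zs) - w by rewrite /w [RHS]addrC opprB addrA subrK.
have -> : z + l *: (zb - z) - zs = (z - zs) + (- l) *: w.
  by rewrite scaleNr -scalerN opprB addrAC.
move: (z - zs) => u; rewrite qformDZ// (innerC (P *m w)) innerDl -scaleN1r.
rewrite innerZl -/(qform P w).
have [q0|q_neq0] := eqVneq (qform P w) 0.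
  have -> : P *m w = 0 by apply: mnorm_eq0 => //; rewrite /mnorm q0 sqrtr0.
  have -> : inner u 0 = 0 by rewrite -(scale0r 0) innerZr mul0r.
  by rewrite q0 !mulr0 !addr0 subr0.
have -> : qform V (P *m w) = (a - 1) * qform P w.
  by rewrite (aE q_neq0) addrC addrA addNr add0r mulfVK.
rewrite -[qform P u + _ + _]addrA lerD2l => h.
have := ler_wpM2l (ltW l0) h; nra.
Qed.

(** P (z - zb) is an element of T zb, so the distance of 0 to T zb is at most
    |P|^(1/2) times the seminorm of z - zb; subregularity converts it into a
    distance of zb to the zeros, and passing from the Euclidean norm back to the
    seminorm costs another factor |P|^(1/2). *)
Lemma error_bound (z zb : E) zeta : zer T !=set0 -> 0 <= zeta ->
  T zb (P *m (z - zb)) ->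
  dist (@enorm R n) zb (zer T) <= zeta * dist (@enorm R n) 0 (T zb) ->
  dist (mnorm P) z (zer T) <= (1 + zeta * spectral_norm P) * mnorm P (z - zb).
Proof.
move=> S0 zeta0 Tzb sub.
pose s := Num.sqrt (spectral_norm P).
have s2 : s * s = spectral_norm P.
  by rewrite -expr2 sqr_sqrtr// spectral_norm_ge0.
have s0 : 0 <= s by exact: sqrtr_ge0.
have dT : dist (@enorm R n) 0 (T zb) <= s * mnorm P (z - zb).
  apply: le_trans (enorm_mulmx_le_mnorm _ Psym Ppsd).
  rewrite -[P *m _]subr0; apply: dist_le => //; exact: enorm_ge0.
have dz : dist (mnorm P) z (zer T) - mnorm P (z - zb) <=
          s * dist (@enorm R n) zb (zer T).
  (* Scaling the infimum needs s > 0; if s = 0 the seminorm vanishes. *)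
  have [s_eq0|s_neq0] := eqVneq s 0.
    have [e Se] := S0; rewrite s_eq0 mul0r subr_le0.
    apply: le_trans (dist_le _ (mnorm_ge0 P) Se) _.
    rewrite mnormBC.
    have -> : z - e = (z - zb) + (zb - e) by rewrite addrA subrK.
    apply: le_trans (mnormD _ _ Psym Ppsd) _.
    rewrite gerDl; apply: le_trans (mnorm_le_enorm _ Ppsd) _.
    by rewrite -/s s_eq0 mul0r.
  have s_gt0 : 0 < s by rewrite lt_neqAle eq_sym s_neq0.
  rewrite mulrC -ler_pdivrMr//; apply: le_dist => // e Se.
  rewrite ler_pdivrMr// lerBlDl.
  apply: le_trans (dist_le _ (mnorm_ge0 P) Se) _.
  rewrite mnormBC; have -> : z - e = (z - zb) + (zb - e) by rewrite addrA subrK.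
  apply: le_trans (mnormD _ _ Psym Ppsd) _.
  by rewrite lerD2l mnormBC mulrC mnorm_le_enorm.
rewrite mulrDl mul1r -lerBlDl; apply: le_trans dz _.
have -> : zeta * spectral_norm P * mnorm P (z - zb) =
          s * (zeta * (s * mnorm P (z - zb))).
  by rewrite -s2; ring.
by rewrite ler_wpM2l// (le_trans sub)// ler_wpM2l.
Qed.

End Step.

(** * Linear convergence *)

Lemma cvg_decrease (R : realType) (a q : nat -> R) kappa : 0 < kappa ->
  (forall k, 0 <= a k) -> (forall k, 0 <= q k) -> (forall k, a k.+1 <= a k) ->
  (\forall k \near \oo, a k.+1 <= a k - kappa * q k) -> q @ \oo --> 0.
Proof.
move=> kappa0 a0 q0 amono aq.
have /cvg_ex[l al] : cvgn a.
  apply: nonincreasing_is_cvgn; last by exists 0 => _ [k _ <-].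
  exact/nonincreasing_seqP.
have dl : kappa^-1 * (a k - a k.+1) @[k --> \oo] --> 0.
  rewrite -(mulr0 kappa^-1) -(subrr l); apply: cvgMr.
  by apply: cvgB => //; rewrite cvg_shiftS.
apply: squeeze_cvgr (cvg_cst 0) dl.
apply: filterS aq => k ak; rewrite q0/= mulrC ler_pdivlMr//.
by rewrite mulrC lerBrDl -lerBrDr.
Qed.

Unset Implicit Arguments.

Theorem theorem2p13 (R : realType) (n : nat)
  (T : 'cV[R]_n -> set 'cV[R]_n) (P V : 'M[R]_n)
  (r : nat) (U : 'M[R]_(n, r)) (zeta kappa : R)
  (z zbar : nat -> 'cV[R]_n) (lam alpha : nat -> R)
  (* (A1) *)
  (T_osc : outer_semicontinuous T)
  (* (A2) *)
  (res_dom : set_dom (preconditioned_resolvent P T) = setT)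
  (res_cont : single_valued_continuous (preconditioned_resolvent P T))
  (* (A3) *)
  (zer_neq0 : zer T !=set0)
  (zer_closed : closed (zer T))
  (zer_convex : convex_set (zer T))
  (V_sym : V^T = V)
  (minty : oblique_weak_minty V T (zer T))
  (* (A4) *)
  (P_sym : P^T = P)
  (P_psd : psd P)
  (U_basis : orthonormal_range_basis P U)
  (eta_gt0 : 0 < 1 + lambda_min (U^T *m V *m P *m U))
  (* (A5) *)
  (zeta_ge0 : 0 <= zeta)
  (subreg : forall zs, zer T zs -> metrically_subregular T zs 0 zeta)
  (* the iteration; alpha k is unconstrained where its formula reads 0 / 0 *)
  (iter : PPPA P T lam z zbar)
  (alphaE : forall k, qform P (z k - zbar k) != 0 ->
     alpha k = 1 + qform V (P *m (z k - zbar k)) / qform P (z k - zbar k))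
  (lam_bounds : forall k, 0 < lam k < 2 * alpha k)
  (kappa_gt0 : 0 < kappa)
  (lam_kappa : \forall k \near \oo, kappa <= lam k * (2 * alpha k - lam k)) :
  let Pi := proj_range P in
  let Q := P + proj_ker P in
  let Pi_zer := [set Pi *m x | x in zer T] in
  [/\ Qlinear (fun x : R => `|x|)
        (fun k => dist (mnorm Q) (Pi *m z k) Pi_zer) 0
        (Num.sqrt (1 - kappa / (1 + zeta * spectral_norm P) ^+ 2)),
      exists2 zs, Pi_zer zs & Rlinear (@enorm R n) (fun k => Pi *m z k) zs &
      Rlinear (fun x : R => `|x|) (fun k => qform P (z k - zbar k)) 0].
Proof.
move=> Pi Q Pi_zer.
pose q k := qform P (z k - zbar k).
pose d k := dist (mnorm P) (z k) (zer T).
have -> : (fun k => dist (mnorm Q) (Pi *m z k) Pi_zer) = d.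
  by apply/funext => k; exact: dist_proj_range.
have [f fcont resE] := res_cont.
have zbarE k : zbar k = f (z k) by have [+ _] := iter k; rewrite resE.
have fP x y : P *m x = P *m y -> f x = f y.
  move=> xy; have : preconditioned_resolvent P T x (f x) by rewrite resE.
  rewrite /preconditioned_resolvent xy.
  by rewrite -/(preconditioned_resolvent P T y (f x)) resE.
have fzer x : P *m x = P *m f x -> zer T (f x).
  move=> xfx; have : preconditioned_resolvent P T x (f x) by rewrite resE.
  by move=> /resolventP; rewrite mulmxBr xfx subrr.
have fejer k s : zer T s -> qform P (z k.+1 - s) <=
    qform P (z k - s) - lam k * (2 * alpha k - lam k) * q k.
  have [res ->] := iter k; have /andP[lam0 _] := lam_bounds k.
  move=> Ss; have aE := alphaE k.
  exact: (relaxed_step_fejer P_sym P_psd minty Ss res aE lam0).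
have mono k s : zer T s -> qform P (z k.+1 - s) <= qform P (z k - s).
  move=> Ss; apply: le_trans (fejer k s Ss) _; rewrite gerBl mulr_ge0 ?P_psd//.
  by have /andP[l0 l2] := lam_bounds k; rewrite mulr_ge0 ?subr_ge0 ?ltW.
have mnorm_mono s k : zer T s -> mnorm P (z k.+1 - s) <= mnorm P (z k - s).
  by move=> Ss; rewrite ler_wsqrtr// mono.
have decr : \forall k \near \oo, forall s, zer T s ->
    qform P (z k.+1 - s) <= qform P (z k - s) - kappa * q k.
  apply: filterS lam_kappa => k kk s Ss; apply: le_trans (fejer k s Ss) _.
  by rewrite lerB// ler_wpM2r ?P_psd.
have q0 : q @ \oo --> 0.
  have [s Ss] := zer_neq0.
  apply: (@cvg_decrease _ (fun k => qform P (z k - s)) _ kappa) => //.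
  - by move=> k; exact: P_psd.
  - by move=> k; exact: mono.
  - by apply: filterS decr => k /(_ s Ss).
have w0 : mnorm P (z k - f (z k)) @[k --> \oo] --> 0.
  have -> : (fun k => mnorm P (z k - f (z k))) = Num.sqrt \o q.
    by apply/funext => k; rewrite -zbarE.
  have s0 : Num.sqrt @ (0 : R) --> Num.sqrt (0 : R) by exact: sqrt_continuous.
  by rewrite sqrtr0 in s0; exact: cvg_comp q0 s0.
have [zs Szs [zs0 fzs]] : exists2 zs, zer T zs &
    mnorm P (z k - zs) @[k --> \oo] --> 0 /\ f (z k) @[k --> \oo] --> zs.
  exact: (fejer_convergence P_sym P_psd).
set K := 1 + zeta * spectral_norm P.
have K0 : 0 < K by rewrite ltr_wpDr// mulr_ge0// spectral_norm_ge0.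
have d0 k : 0 <= d k by apply: le_dist => // e _; exact: mnorm_ge0.
have dq : \forall k \near \oo, d k <= K * mnorm P (z k - zbar k).
  have [_ sub] := subreg _ Szs.
  have sub_near : \forall k \near \oo, T (f (z k)) !=set0 ->
      dist (@enorm R n) (f (z k)) (zer T) <=
      zeta * dist (@enorm R n) 0 (T (f (z k))) by exact: fzs _ sub.
  apply: filterS sub_near => k; rewrite -zbarE.
  have Tk : T (zbar k) (P *m (z k - zbar k)).
    by apply/resolventP; have [] := iter k.
  move=> /(_ (ex_intro _ _ Tk)).
  by move=> /(error_bound P_sym P_psd zer_neq0 zeta_ge0 Tk).
have d_decr : \forall k \near \oo, d k.+1 ^+ 2 <= d k ^+ 2 - kappa * q k.
  apply: filterS decr => k dk.
  (* The inequality is turned into one where d k is bounded from below by a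
     quantity free of s, so that the infimum defining d k can be taken. *)
  have e0 : 0 <= d k.+1 ^+ 2 + kappa * q k.
    by rewrite addr_ge0 ?sqr_ge0// mulr_ge0 ?P_psd// ltW.
  rewrite lerBrDr -(sqr_sqrtr e0) lerXn2r ?nnegrE ?sqrtr_ge0//.
  apply: le_dist => // s Ss; rewrite mnormBC ler_wsqrtr//.
  rewrite -lerBrDr; apply: le_trans (dk s Ss).
  rewrite -sqr_mnorm// lerXn2r ?nnegrE ?mnorm_ge0// [leRHS]mnormBC.
  by apply: dist_le => //; exact: mnorm_ge0.
set c := Num.sqrt _.
have dQ : Qlinear (fun x : R => `|x|) d 0 c.
  split.
    by rewrite sqrtr_ge0 -sqrtr1 ltr_sqrt ?ltr01// gtrBl divr_gt0// exprn_gt0.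
  move: dq d_decr; apply: filterS2 => k dk ddk; rewrite !subr0 !ger0_norm//.
  have : d k.+1 ^+ 2 <= d k ^+ 2 * (1 - kappa / K ^+ 2).
    apply: le_trans ddk _; rewrite mulrBr mulr1 lerB// mulrCA.
    rewrite ler_wpM2l ?(ltW kappa_gt0)// ler_pdivrMr ?exprn_gt0//.
    rewrite /q -sqr_mnorm//.
    by rewrite mulrC -exprMn lerXn2r ?nnegrE// mulr_ge0 ?mnorm_ge0// ltW.
  (* If kappa > K ^+ 2 this says that d k.+1 = 0, in accordance with c = 0. *)
  by move=> /ler_wsqrtr;
    rewrite sqrtr_sqr sqrtrM ?sqr_ge0// sqrtr_sqr !ger0_norm// mulrC.
have [C C0 hC] := enorm_proj_range P_sym P_psd.
have zsd k : mnorm P (z k - zs) <= 2 * d k.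
  by apply: (fejer_limit_dist P_sym P_psd).
split => //.
- exists (Pi *m zs); first by exists zs.
  apply: (Rlinear_dominated (K := C * 2) _ d0 _ dQ).
  + exact: enorm_ge0.
  + by rewrite mulr_ge0.
  + apply: nearW => k; rewrite -mulmxBr; apply: le_trans (hC _) _.
    by rewrite -mulrA ler_wpM2l.
- have d2Q : Qlinear (fun x : R => `|x|) (fun k => d k ^+ 2) 0 (c ^+ 2).
    have [/andP[c0 c1] dc] := dQ; split; first by rewrite sqr_ge0 exprn_ilt1.
    apply: filterS dc => k; rewrite !subr0 !normrX -exprMn => dc.
    by rewrite lerXn2r ?nnegrE ?mulr_ge0.
  apply: (Rlinear_dominated (K := kappa^-1) _ _ _ d2Q).
  + by move=> u; exact: normr_ge0.
  + by move=> k; exact: sqr_ge0.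
  + by rewrite invr_ge0 ltW.
  + apply: filterS d_decr => k dk; rewrite subr0 ger0_norm ?P_psd//.
    rewrite mulrC ler_pdivlMr// mulrC -subr_ge0; apply: le_trans dk.
    exact: sqr_ge0.
Qed.
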